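(* Let $p$ be a prime and $n\ge2$, $e\ge1$ integers. Then \[g_n(p^e)\geq \sum_{j=1}^{\lfloor e/n\rfloor} p^{(n-2)j}\left( \binom{e-1-nj}{n-2}-\binom{e-1-n(j+1)}{n-2}\right).\]
   Context: $\mathbb{Z}^n$ denotes the ring of integer $n$-tuples with componentwise operations. A subring of $\mathbb{Z}^n$ is a finite-index additive subgroup containing $(1,\dots,1)$ and closed under componentwise multiplication; it is irreducible if for every vector $(x_1,\dots,x_n)$ in it, $x_1\equiv\cdots\equiv x_n\pmod p$. $g_n(p^e)$ is the number of irreducible subrings of $\mathbb{Z}^n$ of index $p^e$. Binomial coefficients $\binom{a}{b}$ with $a<b$ (including negative $a$) are interpreted as $0$. *)

(* Defs.v *)
From HB Require Import structures.
From mathcomp Require Import all_boot all_order all_algebra.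
From mathcomp Require Import finmap all_classical.

Set Implicit Arguments.
Unset Strict Implicit.
Unset Printing Implicit Defensive.

Import Order.TTheory GRing.Theory Num.Theory.

Local Open Scope classical_set_scope.
Local Open Scope ring_scope.

(* The ring structure of finite functions in ssralg is the pointwise one. *)
Definition Zn (n : nat) : pzRingType := {ffun 'I_n -> int}.

Definition coset_set (n : nat) (S : set (Zn n)) (x : Zn n) : set (Zn n) :=
  [set y | S (y - x)].

Definition cosets (n : nat) (S : set (Zn n)) : set (set (Zn n)) :=
  range (coset_set S).

Definition has_index (n : nat) (S : set (Zn n)) (k : nat) : Prop :=
  (cosets S #= `I_k)%card.

Definition is_subring (n : nat) (S : set (Zn n)) : Prop :=
  finite_set (cosets S) /\ GRing.subring_closed [in S].

Definition irreducible_mod (p n : nat) (S : set (Zn n)) : Prop :=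
  forall x : Zn n, S x -> forall i j : 'I_n, (x i = x j %[mod p%:Z])%Z.

Definition irr_subrings (n p e : nat) : set (set (Zn n)) :=
  [set S | [/\ is_subring S, irreducible_mod p S & has_index S (p ^ e)%N]].
Arguments irr_subrings : clear implicits.

(* [fset_set] is the empty set on an infinite argument. *)
Definition g (n p e : nat) : nat := #|` fset_set (irr_subrings n p e)|.

(* 'C(k, b) is already 0 for 0 <= k < b; a negative upper entry also gives 0,
   even when b = 0. *)
Definition binz (a : int) (b : nat) : int :=
  if a is Posz k then 'C(k, b)%:Z else 0.

(* Main.v *)
From HB Require Import structures.
Require Import Defs.
From mathcomp Require Import all_boot all_order all_algebra.
From mathcomp Require Import finmap all_classical.
From mathcomp Require Import zify ring.

(** For exponents [alpha_0, ..., alpha_(n-2)] of sum [e], consider the lattice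
    spanned by [1], [p^alpha_0 e_1] and [p^alpha_i e_(i+1) + b_i e_1] for
    [1 <= i <= n-2].  Taking [b_i] to be a multiple of [p^(alpha_0 - j)], the
    lattice is multiplicatively closed as soon as [alpha_0 >= 2 j] and
    [alpha_i >= j], and it has index [p^e]; it is in Hermite normal form, so it
    determines [alpha] and the residues [b_i] modulo [p^alpha_0], of which there
    are [p^((n-2) j)].  The exponents with [alpha_0 >= 2 j + 1] and
    [alpha_i >= j + 1] number [binom (e - 1 - n j) (n - 2)] by stars and bars;
    choosing for each [alpha] the largest such [j] gives the bound. *)

Set Implicit Arguments.
Unset Strict Implicit.
Unset Printing Implicit Defensive.

Import Order.TTheory GRing.Theory Num.Theory.

Local Open Scope classical_set_scope.
Local Open Scope ring_scope.

(** * The index as a count of fibres *)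

Lemma card_finType (T : finType) : ([set: T] #= `I_#|T|)%card.
Proof.
apply: card_eq_trans (card_esym card_II).
apply/card_esym; rewrite -(_ : @enum_rank T @` setT = setT).
  by apply: inj_card_eq => x y _ _; exact: enum_rank_inj.
by apply/seteqP; split=> // i _; exists (enum_val i) => //; rewrite enum_valK.
Qed.

(** The fibres of [f] are exactly the cosets of [S], and surjectivity makes distinct values have
    distinct fibres. *)
Lemma has_index_fibres (n : nat) (S : set (Zn n)) (T : finType) (f : Zn n -> T) :
  (forall x y, f x = f y <-> S (x - y)) -> (forall t, exists x, f x = t) ->
  has_index S #|T|.
Proof.
move=> fS fsurj; apply: card_eq_trans (card_finType T).
have -> : cosets S = (fun t => [set y | f y = t]) @` [set: T].
  apply/seteqP; split=> [_ [x _ <-]|_ [t _ <-]].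
    by exists (f x) => //; apply/seteqP; split=> y /= /fS.
  by have [x <-] := fsurj t; exists x => //; apply/seteqP; split=> y /= /fS.
apply: inj_card_eq => t u _ _ eq_tu.
by have [x xt] := fsurj t; have : [set y | f y = t] x by [];
   rewrite eq_tu /= xt.
Qed.

(** * The lattice: closure under products, irreducibility, index *)

Section Lattice.
Variables (m : nat) (D : 'I_m.+1 -> nat) (b : 'I_m -> int).

Definition rel_coord (x : Zn m.+2) (k : 'I_m.+1) : int :=
  x (lift ord0 k) - x ord0.

(* The lattice spanned by [1], [D 0 e_1] and [D i e_(i+1) + b (i-1) e_1]
   for [1 <= i <= m]; coordinates are numbered from [0]. *)
Definition lattice : set (Zn m.+2) :=
  [set x | exists c : 'I_m -> int,
     (forall i, rel_coord x (lift ord0 i) = c i * (D (lift ord0 i))%:Z) /\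
     ((D ord0)%:Z %| rel_coord x ord0 - \sum_i c i * b i)%Z].

Lemma rel_coordB x y k : rel_coord (x - y) k = rel_coord x k - rel_coord y k.
Proof. by rewrite /rel_coord !ffunE /=; ring. Qed.

Lemma rel_coord1 k : rel_coord 1 k = 0.
Proof. by rewrite /rel_coord !ffunE subrr. Qed.

Lemma rel_coordM x y k : rel_coord (x * y) k =
  x ord0 * rel_coord y k + y ord0 * rel_coord x k + rel_coord x k * rel_coord y k.
Proof. by rewrite /rel_coord !ffunE /=; ring. Qed.

Section Closed.
Variable h : int.
Hypotheses (hb : forall i, (h %| b i)%Z) (hD : (h %| (D ord0)%:Z)%Z).
Hypothesis Dhh : ((D ord0)%:Z %| h * h)%Z.
Hypothesis DDb : forall i, ((D ord0)%:Z %| (D (lift ord0 i))%:Z * b i)%Z.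

Lemma dvdz_rel_coord0 x : lattice x -> (h %| rel_coord x ord0)%Z.
Proof.
case=> c [_ /(dvdz_trans hD) Hx].
rewrite -[rel_coord _ _](subrK (\sum_i c i * b i)) rpredD //.
by apply: rpred_sum => i _; rewrite dvdz_mull.
Qed.

(** By [rel_coordM], a product is [x ord0] times [y] plus [y ord0] times [x] plus the entrywise
    product, in relative coordinates. The first two parts stay in the lattice by linearity. In the
    third, entry [ord0] is a product of two multiples of [h], killed modulo [D ord0] by [Dhh], and
    the correction by the [b i] is killed by [DDb]. *)
Lemma lattice_subring : GRing.subring_closed [in lattice].
Proof.
split=> [|x y|x y]; rewrite !inE.
- exists (fun=> 0); split=> [i|]; first by rewrite rel_coord1 mul0r.
  by rewrite rel_coord1 big1 ?subr0 ?dvdz0 // => i _; rewrite mul0r.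
- move=> [c [cx dx]] [d [dy ddy]]; exists (fun i => c i - d i); split=> [i|].
    by rewrite rel_coordB cx dy mulrBl.
  rewrite rel_coordB (_ : \sum_i _ = \sum_i c i * b i - \sum_i d i * b i).
    rewrite (_ : _ - _ = rel_coord x ord0 - \sum_i c i * b i -
      (rel_coord y ord0 - \sum_i d i * b i)); last by ring.
    exact: rpredB.
  by rewrite -sumrB; apply: eq_bigr => i _; rewrite mulrBl.
- move=> Lx Ly; have hx := dvdz_rel_coord0 Lx; have hy := dvdz_rel_coord0 Ly.
  case: Lx => [c [cx dx]]; case: Ly => [d [dy ddy]].
  exists (fun i => x ord0 * d i + y ord0 * c i + c i * d i * (D (lift ord0 i))%:Z).
  split=> [i|]; first by rewrite rel_coordM cx dy; ring.
  rewrite rel_coordM (_ : \sum_i _ = x ord0 * (\sum_i d i * b i) +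
    y ord0 * (\sum_i c i * b i) +
    \sum_i c i * d i * ((D (lift ord0 i))%:Z * b i)); last first.
    by rewrite !mulr_sumr -!big_split; apply: eq_bigr => i _ /=; ring.
  set s1 := \sum_i d i * b i in ddy *; set s2 := \sum_i c i * b i in dx *.
  set s3 := \sum_i _.
  rewrite (_ : _ - _ = x ord0 * (rel_coord y ord0 - s1) +
     y ord0 * (rel_coord x ord0 - s2) + rel_coord x ord0 * rel_coord y ord0 - s3).
    rewrite rpredB ?rpredD ?(dvdz_mull _ ddy) ?(dvdz_mull _ dx) //.
      by apply: dvdz_trans Dhh _; rewrite dvdz_mul.
    by apply: rpred_sum => i _; rewrite dvdz_mull.
  by ring.
Qed.

Lemma lattice_irreducible (p : nat) :
  (p%:Z %| h)%Z -> (forall i, (p%:Z %| (D (lift ord0 i))%:Z)%Z) ->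
  irreducible_mod p lattice.
Proof.
move=> ph pD x Lx.
suff xk k : (x k = x ord0 %[mod p%:Z])%Z by move=> i j; rewrite !xk.
apply/eqP; rewrite eqz_mod_dvd; case: (unliftP ord0 k) => [k' ->|->]; last first.
  by rewrite subrr dvdz0.
rewrite -/(rel_coord x k'); case: (unliftP ord0 k') => [i ->|->].
  by have [c [-> _]] := Lx; rewrite dvdz_mull.
by apply: dvdz_trans ph _; apply: dvdz_rel_coord0.
Qed.

End Closed.

Hypothesis D_gt0 : forall k, (0 < D k)%N.

(** Straightening coordinates: membership in the lattice becomes independent congruences modulo the
    [D k]. The floor quotient stands in for the coefficient [c i], which a general vector need not
    have, so the map need not be additive. *)
Definition shear (x : Zn m.+2) (k : 'I_m.+1) : int :=
  if unlift ord0 k is Some i then rel_coord x k else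
  rel_coord x ord0 -
    \sum_i (rel_coord x (lift ord0 i) %/ (D (lift ord0 i))%:Z)%Z * b i.

Lemma shearP x y :
  (forall k, (shear x k = shear y k %[mod (D k)%:Z])%Z) <-> lattice (x - y).
Proof.
have D0 k : (D k)%:Z != 0 :> int by rewrite -lt0n.
split=> [Hxy | [c [cx dx]] k].
  (* Entries with equal remainders differ by the modulus times the difference of their quotients. *)
  pose c i : int := (rel_coord x (lift ord0 i) %/ (D (lift ord0 i))%:Z)%Z -
     (rel_coord y (lift ord0 i) %/ (D (lift ord0 i))%:Z)%Z.
  exists c; split=> [i|].
    have := Hxy (lift ord0 i); rewrite /shear liftK => Hi.
    rewrite rel_coordB {1}(divz_eq (rel_coord x _) (D (lift ord0 i))%:Z).
    rewrite {1}(divz_eq (rel_coord y _) (D (lift ord0 i))%:Z) Hi /c; ring.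
  have /eqP := Hxy ord0; rewrite eqz_mod_dvd /shear unlift_none rel_coordB.
  rewrite (_ : \sum_i c i * b i = \sum_i
    (rel_coord x (lift ord0 i) %/ (D (lift ord0 i))%:Z)%Z * b i - \sum_i
    (rel_coord y (lift ord0 i) %/ (D (lift ord0 i))%:Z)%Z * b i).
    by congr (_ %| _)%Z; ring.
  by rewrite -sumrB; apply: eq_bigr => i _; rewrite mulrBl.
apply/eqP; rewrite eqz_mod_dvd /shear; case: (unliftP ord0 k) => [i ->|->].
  by rewrite -rel_coordB cx dvdz_mull.
move: dx; rewrite rel_coordB; congr (_ %| _)%Z.
rewrite (_ : \sum_i c i * b i = \sum_i
    (rel_coord x (lift ord0 i) %/ (D (lift ord0 i))%:Z)%Z * b i - \sum_i
    (rel_coord y (lift ord0 i) %/ (D (lift ord0 i))%:Z)%Z * b i); first by ring.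
rewrite -sumrB; apply: eq_bigr => i _; rewrite -mulrBl; congr (_ * _).
have := cx i; rewrite rel_coordB => /eqP; rewrite subr_eq => /eqP ->.
by rewrite divzMDl // addrK.
Qed.

(** The residues of [shear] modulo the [D k] label the cosets and take every combination of
    values. *)
Lemma lattice_index : has_index lattice (\prod_k D k)%N.
Proof.
(* Writing [(D k).-1.+1] gives the successor form that [inord] requires. *)
pose T := {dffun forall k : 'I_m.+1, 'I_(D k).-1.+1}.
have -> : (\prod_k D k)%N = #|T|.
  rewrite card_dep_ffun foldrE big_map big_enum /=.
  by apply: eq_bigr => k _; rewrite card_ord prednK.
have Dp k : (D k).-1.+1 = D k by rewrite prednK.
have D0 k : (D k)%:Z != 0 :> int by rewrite -lt0n.
have modD (z : int) k : (`|(z %% (D k)%:Z)%Z| < (D k).-1.+1)%N.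
  have := modz_ge0 z (D0 k); have := @ltz_pmod z (D k)%:Z; have := D_gt0 k; lia.
pose f (x : Zn m.+2) : T :=
  [ffun k => inord `|(shear x k %% (D k)%:Z)%Z|%N].
apply: (has_index_fibres (f := f)) => [x y|t].
  rewrite -shearP; split=> [fxy k|fxy]; last first.
    by apply/ffunP => k; rewrite !ffunE fxy.
  have := congr1 (fun u : T => val (u k)) fxy; rewrite !ffunE /= !inordK //.
  have := modz_ge0 (shear x k) (D0 k); have := modz_ge0 (shear y k) (D0 k); lia.
(* A preimage of [t] has the residues themselves as relative coordinates: they lie below the [D k],
   so all quotients vanish and [shear] returns [t]. *)
exists [ffun i => if unlift ord0 i is Some k then (t k : nat)%:Z else 0].
set x := finfun _.
have rx k : rel_coord x k = (t k : nat)%:Z.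
  by rewrite /rel_coord !ffunE liftK unlift_none subr0.
have tk k : ((t k : nat) < D k)%N by rewrite -[X in (_ < X)%N]Dp.
apply/ffunP => k; rewrite ffunE; apply: val_inj; rewrite /= inordK //.
have -> : shear x k = (t k : nat)%:Z.
  rewrite /shear; case: (unliftP ord0 k) => [i ->|->]; rewrite rx //.
  rewrite big1 ?subr0 // => i _; rewrite rx divz_small ?mul0r //.
  by have := tk (lift ord0 i); lia.
by rewrite modz_small //; have := tk k; lia.
Qed.

End Lattice.

(** * Recovering the parameters from the lattice *)

Section Injective.
Variables (m : nat).
Implicit Types (D : 'I_m.+1 -> nat) (b : 'I_m -> int).

(** The inclusion is tested on generators of the smaller lattice. The triangular shape yields the
    divisibilities of the diagonal; once the diagonals agree, the coefficients of a generator are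
    forced to be 0 or 1, and only the residue of [b i] remains. *)
Lemma lattice_sub_dvd D b D' b' :
  (forall k, 0 < D' k)%N -> lattice D b `<=` lattice D' b' ->
  (forall k, (D' k %| D k)%N) /\
  (D =1 D' -> forall i, (b i = b' i %[mod (D ord0)%:Z])%Z).
Proof.
move=> D'_gt0 sub.
have D0 k : (D' k)%:Z != 0 :> int by rewrite -lt0n.
have L0 : lattice D' b' [ffun k => if k == lift ord0 ord0 then (D ord0)%:Z else 0].
  apply: sub; exists (fun=> 0); split=> [i|].
    by rewrite /rel_coord !ffunE /= mul0r subr0.
  by rewrite /rel_coord big1 => [|i _]; rewrite ?mul0r // !ffunE /= !subr0 dvdzz.
have L1 i : lattice D' b' [ffun k => if k == lift ord0 ord0 then b i else
     if k == lift ord0 (lift ord0 i) then (D (lift ord0 i))%:Z else 0].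
  apply: sub; exists (fun k => (k == i)%:R); split=> [k|].
    rewrite /rel_coord !ffunE /= subr0 !(inj_eq lift_inj) /=.
    by case: eqP => [->|]; rewrite ?mul1r ?mul0r.
  rewrite /rel_coord (bigD1 i) //= big1 => [|k /negPf ->]; last by rewrite mul0r.
  by rewrite !ffunE /= eqxx subr0 mul1r addr0 subrr dvdz0.
split=> [k|eqD i].
  case: (unliftP ord0 k) => [i ->|->]; last first.
    have [c [c0]] := L0; rewrite /rel_coord !ffunE /= subr0 big1 ?subr0 //.
    move=> i _; have := c0 i; rewrite /rel_coord !ffunE /= subr0.
    by move=> /esym/eqP; rewrite mulf_eq0 (negPf (D0 _)) orbF => /eqP ->; rewrite mul0r.
  have [c [c0 _]] := L1 i; have := c0 i; rewrite /rel_coord !ffunE /= eqxx subr0 => Hc.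
  by have : ((D' (lift ord0 i))%:Z %| (D (lift ord0 i))%:Z)%Z by rewrite Hc dvdz_mull.
have [c [c0]] := L1 i; rewrite /rel_coord !ffunE /= subr0 => Hd.
have ci k : c k = (k == i)%:R.
  have := c0 k; rewrite /rel_coord !ffunE /= subr0 !(inj_eq lift_inj) /=.
  case: eqP => [->|_] /esym/eqP; last by rewrite mulf_eq0 (negPf (D0 _)) orbF => /eqP.
  rewrite eqD -subr_eq0 -{2}[(D' _)%:Z]mul1r -mulrBl mulf_eq0.
  by rewrite (negPf (D0 _)) orbF subr_eq0 => /eqP.
move: Hd; rewrite (bigD1 i) //= big1 => [|k /negPf ki]; last by rewrite ci ki mul0r.
by rewrite ci eqxx mul1r addr0 -eqD -eqz_mod_dvd => /eqP.
Qed.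

End Injective.

(** * Finiteness of the set of irreducible subrings *)

Section Finite.
Variable n : nat.

Lemma subring_natmul (S : set (Zn n)) x k :
  GRing.subring_closed [in S] -> S x -> S (x *+ k).
Proof.
move=> [S1 SB _] Sx.
have S0 : S 0 by have := SB _ _ S1 S1; rewrite subrr inE.
have SN y : S y -> S (- y).
  by move=> Sy; have := SB 0 y; rewrite sub0r !inE; apply.
elim: k => [|k IH]; first by rewrite mulr0n.
have := SB (x *+ k) (- x); rewrite opprK -mulrSr !inE; apply => //; exact: SN.
Qed.

(* Two of the cosets of [0, x, ..., k x] coincide. *)
Lemma subring_fact_index (S : set (Zn n)) k (x : Zn n) :
  GRing.subring_closed [in S] -> has_index S k -> S (x *+ k`!).
Proof.
move=> SS /card_set_bijP[f [fI finj _]].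
have S0 : S 0 by have [S1 SB _] := SS; have := SB _ _ S1 S1; rewrite subrr inE.
pose c (i : nat) := coset_set S (x *+ i).
have fc i : (f (c i) < k)%N by apply: fI; exists (x *+ i).
pose F (i : 'I_k.+1) : 'I_k := Ordinal (fc i).
have /injectivePn[i [j ij Fij]] : ~~ injectiveb F.
  by apply/negP => /injectiveP /leq_card; rewrite !card_ord ltnn.
have cij : c i = c j.
  apply: finj; rewrite ?inE; [by exists (x *+ i)|by exists (x *+ j)|].
  exact: (congr1 val Fij).
wlog lt_ij : i j ij cij {Fij} / (i < j)%N.
  move=> H; case: (ltngtP i j) => [| |/val_inj /eqP]; last by rewrite (negPf ij).
    exact: H.
  by apply: H; rewrite // eq_sym.
have Sji : S (x *+ (j - i)).
  have : c j (x *+ j) by rewrite /c /coset_set /= subrr.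
  by rewrite -cij /c /coset_set /= -mulrnBr // ltnW.
(* The gap [j - i] is at most [k], so one factorial serves every possible gap. *)
have : (j - i %| k`!)%N by rewrite dvdn_fact //; have := ltn_ord j; lia.
by case/dvdnP => q ->; rewrite mulnC mulrnA; apply: subring_natmul.
Qed.

(** Each such subring contains every multiple of [N], hence is determined by its points with entries
    in [[0, N)]. Finiteness keeps [fset_set] in [g] away from its default value. *)
Lemma finite_irr_subrings p e : finite_set (irr_subrings n p e).
Proof.
set A := irr_subrings n p e; pose N := (p ^ e)`!.
pose lft (t : {ffun 'I_n -> 'I_N}) : Zn n := [ffun i => (t i : nat)%:Z].
pose Phi (S : set (Zn n)) : {set {ffun 'I_n -> 'I_N}} :=
  [set t | `[< S (lft t) >]]%SET.
suff inj : {in A &, injective Phi}.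
  by rewrite -(eq_finite_set (inj_card_eq inj)); apply: finite_finset.
have N0 : N%:Z != 0 :> int by rewrite -lt0n fact_gt0.
have red x : exists t y, x = lft t + y *+ N.
  have H i : (`|(x i %% N%:Z)%Z| < N)%N.
    have := modz_ge0 (x i) N0; have := @ltz_pmod (x i) N%:Z.
    have := fact_gt0 (p ^ e); rewrite -/N; lia.
  exists [ffun i => Ordinal (H i)], [ffun i => (x i %/ N%:Z)%Z].
  apply/ffunP => i; rewrite !ffunE ffunMnE ffunE /=.
  rewrite gez0_abs ?modz_ge0 // {1}(divz_eq (x i) N%:Z) addrC; congr (_ + _).
  by rewrite -mulr_natr natz.
suff sub S S' : A S -> A S' -> Phi S = Phi S' -> S `<=` S'.
  move=> S S'; rewrite !inE => AS AS' eqS; apply/seteqP.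
  by split; apply: sub.
move=> [[_ SS] _ iS] [[_ SS'] _ iS'] eqS x Sx.
have [t [y xE]] := red x; have [_ SB _] := SS; have [S1' SB' _] := SS'.
have St : S (lft t).
  have := SB x (y *+ N); rewrite xE addrK !inE; apply; first by rewrite -xE.
  exact: subring_fact_index.
have St' : S' (lft t).
  have : t \in Phi S by rewrite inE; apply/asboolP.
  by rewrite eqS inE => /asboolP.
have SN' : S' (- (y *+ N)).
  have := SB' 0 (y *+ N); rewrite sub0r !inE; apply.
    by have := SB' _ _ S1' S1'; rewrite subrr inE.
  exact: subring_fact_index.
by have := SB' (lft t) (- (y *+ N)); rewrite opprK -xE !inE; apply.
Qed.

End Finite.

(** * Counting tools, and compositions with prescribed minima *)

Lemma leq_card_fset_set (T : finType) (U : choiceType) (P : {pred T})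
    (f : T -> U) (A : set U) :
  finite_set A -> {in P &, injective f} -> (forall x, x \in P -> A (f x)) ->
  (#|P| <= #|` fset_set A|)%N.
Proof.
move=> finA finj fA; rewrite cardE -(size_map f); apply: uniq_leq_size.
  by rewrite map_inj_in_uniq ?enum_uniq // => x y; rewrite !mem_enum; apply: finj.
move=> y /mapP[x]; rewrite mem_enum => Px ->{y}.
by rewrite in_fset_set // inE; apply: fA.
Qed.

Lemma card_ord_lt n k : (k <= n)%N -> #|[pred z : 'I_n | (z < k)%N]| = k.
Proof.
move=> kn; rewrite -sum1_card (eq_bigl (fun z : 'I_n => z < k)%N) //.
by rewrite (big_ord_narrow kn) sum1_card card_ord.
Qed.

Section Compositions.
Variables m e : nat.

(** Bounding the parts by [e] loses nothing, since they sum to [e], and makes the type finite. *)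
Definition compositions (s : 'I_m.+1 -> nat) : {set {ffun 'I_m.+1 -> 'I_e.+1}} :=
  [set a : {ffun 'I_m.+1 -> 'I_e.+1} |
     (\sum_k (a k : nat) == e)%N && [forall k, s k <= a k]%N]%SET.

(** Subtracting the minima reduces to stars and bars. The guard matters: when the minima exceed [e],
    truncated subtraction would give ['C(m, m) = 1]. *)
Lemma card_compositions s : #|compositions s| =
  (if \sum_k s k <= e then 'C(m + (e - \sum_k s k), m) else 0)%N.
Proof.
case: leqP => [les|lts]; last first.
  apply: eq_card0 => a; rewrite !inE; apply/negP => /andP[/eqP sa /forallP Ha].
  by move: lts; rewrite -sa ltnNge leq_sum.
set d := (e - _)%N; rewrite -card_ord_partitions.
have sle k : (s k <= \sum_k s k)%N by rewrite (bigD1 k) //= leq_addr.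
pose f (t : m.+1.-tuple 'I_d.+1) : {ffun 'I_m.+1 -> 'I_e.+1} :=
  [ffun k => inord (tnth t k + s k)].
have fE t k : f t k = (tnth t k + s k)%N :> nat.
  rewrite ffunE inordK //; have := ltn_ord (tnth t k); have := sle k; rewrite /d; lia.
have finj : injective f.
  move=> t u tu; apply: eq_from_tnth => k; apply: val_inj.
  by apply: (@addIn (s k)); rewrite -!fE tu.
rewrite -(card_imset _ finj); apply: eq_card => a.
apply/idP/imsetP => [|[t]]; rewrite !inE.
  move=> /andP[/eqP sa /forallP Ha].
  have sd : (\sum_k (a k - s k) = d)%N.
    apply: (@addIn (\sum_k s k)); rewrite -big_split /= subnK // -[RHS]sa.
    by apply: eq_bigr => k _; rewrite subnK.
  have ad k : (a k - s k <= d)%N by rewrite -sd (bigD1 k) //= leq_addr.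
  exists [tuple inord (a k - s k) | k < m.+1].
    rewrite inE big_tuple; apply/eqP; rewrite -[RHS]sd; apply: eq_bigr => k _.
    by rewrite tnth_mktuple inordK // ltnS.
  apply/ffunP => k; apply: val_inj; rewrite /= fE tnth_mktuple inordK ?ltnS //.
  by rewrite subnK.
rewrite big_tuple => /eqP st ->; apply/andP; split; last first.
  by apply/forallP => k; rewrite fE leq_addl.
rewrite (eq_bigr (fun k => tnth t k + s k)%N) => [|k _]; last by rewrite fE.
by rewrite big_split /= st subnK.
Qed.

End Compositions.

(** * Exponent vectors available at level [j] *)

Section Exponents.
Variables (m e : nat).

Definition min_exponent (j : nat) (k : 'I_m.+1) : nat :=
  (if k == ord0 then j.*2 else j).+1.

Local Notation exponents j := (compositions e (min_exponent j)).

Lemma sum_min_exponent j : (\sum_k min_exponent j k = m.+2 * j + m.+1)%N.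
Proof.
rewrite big_ord_recl /= (eq_bigr (fun=> j.+1)) //.
by rewrite sum_nat_const card_ord /min_exponent /=; lia.
Qed.

(** The minima total [m.+2 * j + m.+1], so stars and bars has upper entry [e - 1 - m.+2 * j]. If
    they exceed [e], that entry is negative or below [m], and both sides are 0. *)
Lemma card_exponents j :
  (#|exponents j|)%:Z = binz (e%:Z - 1 - m.+2%:Z * j%:Z) m.
Proof.
rewrite card_compositions sum_min_exponent; case: leqP => [le_e|lt_e].
  rewrite (_ : e%:Z - 1 - _ = (m + (e - (m.+2 * j + m.+1)))%N%:Z) //; lia.
case E: (_ - _) => [k|//] /=; rewrite bin_small //; lia.
Qed.

(** Nesting makes [exponents j :\: exponents j.+1] the vectors whose largest level is exactly
    [j]. *)
Lemma exponentsS j j' : (j <= j')%N -> exponents j' \subset exponents j.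
Proof.
move=> jj'; apply/fintype.subsetP => a; rewrite !inE => /andP[-> /forallP Ha] /=.
apply/forallP => k; apply: leq_trans (Ha k); rewrite /min_exponent.
by case: eqP => _; rewrite ltnS ?leq_double.
Qed.

End Exponents.

(** * The family of subrings and its size *)

Section Family.
Variables (p m e : nat).
Hypothesis p_prime : prime p.

Local Notation exponents j := (compositions e (@min_exponent m j)).

(** The level, the exponents, and the multipliers of [p ^ (alpha_0 - j)]. The multipliers live in
    ['I_(p ^ e)] so that their type does not depend on the level; [admissible] cuts them down to
    [p ^ j] values each. *)
Definition params : Type :=
  'I_e.+1 * ({ffun 'I_m.+1 -> 'I_e.+1} * {ffun 'I_m -> 'I_(p ^ e)}).
HB.instance Definition _ := Finite.on params.

Definition admissible : {pred params} := [pred u : params | [&& (0 < u.1)%N,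
  u.2.1 \in exponents u.1 :\: exponents u.1.+1 &
  u.2.2 \in ffun_on [pred z : 'I_(p ^ e) | (z < p ^ u.1)%N]]].

Definition params_lattice (u : params) : set (Zn m.+2) :=
  lattice (fun k => p ^ u.2.1 k)%N
    (fun i => (p ^ (u.2.1 ord0 - u.1) * u.2.2 i)%N%:Z).

Lemma card_admissible : #|admissible| =
  (\sum_(1 <= j < e.+1) #|exponents j :\: exponents j.+1| * p ^ (m * j))%N.
Proof.
pose Q (j : 'I_e.+1) := [predX exponents j :\: exponents j.+1 &
  [pred a : {ffun 'I_m -> 'I_(p ^ e)} |
     a \in ffun_on [pred z : 'I_(p ^ e) | (z < p ^ j)%N]]].
rewrite -sum1_card (eq_bigl (fun u : params => (0 < u.1)%N && Q u.1 u.2)) //.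
rewrite -(pair_big_dep (fun j : 'I_e.+1 => 0 < j)%N Q (fun _ _ => 1%N)) /=.
transitivity (\sum_(j < e.+1 | 0 < j)
    #|exponents j :\: exponents j.+1| * p ^ (m * j))%N.
  apply: eq_bigr => j _; rewrite sum1_card cardX.
  rewrite [X in (_ * X)%N]card_ffun_on card_ord_lt.
    by rewrite card_ord -expnM (mulnC m).
  by rewrite leq_exp2l ?prime_gt1 // -ltnS.
by rewrite big_mkcond big_ord_recl /= add0n big_add1 big_mkord.
Qed.

Lemma params_lattice_irr u : u \in admissible ->
  irr_subrings m.+2 p e (params_lattice u).
Proof.
case: u => j [al a]; rewrite inE => /and3P[/= j0 /finset.setDP[]].
rewrite inE => /andP[/eqP sal /forallP Hal] _ _.
have al0 : (j.*2 < al ord0)%N by have := Hal ord0.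
have ali i : (j < al (lift ord0 i))%N by have := Hal (lift ord0 i).
have D_gt0 k : (0 < p ^ al k)%N by rewrite expn_gt0 prime_gt0.
have idx : has_index (params_lattice (j, (al, a))) (p ^ e).
  by rewrite -[in X in has_index _ X]sal expn_sum; apply: lattice_index.
(* Since [al ord0 >= 2 j], the square of [h] is divisible by [p ^ al ord0]; since
   [al (lift ord0 i) >= j], so is [h] times each other diagonal entry. *)
pose h := (p ^ (al ord0 - j))%N.
have hb i : (h%:Z %| (h * a i)%N%:Z)%Z by rewrite dvdzE /= dvdn_mulr.
have hD : (h%:Z %| (p ^ al ord0)%N%:Z)%Z by rewrite dvdzE /= dvdn_exp2l ?leq_subr.
split=> //.
- split; first by apply/finite_setP; exists (p ^ e)%N.
  apply: (lattice_subring hb hD) => [|i].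
    by rewrite dvdzE /= -expnD dvdn_exp2l //; lia.
  rewrite dvdzE /= mulnA -expnD dvdn_mulr // dvdn_exp2l //.
  by have := ali i; lia.
- apply: (lattice_irreducible hb hD) => [|i].
    by rewrite dvdzE /= dvdn_exp //; lia.
  by rewrite dvdzE /= dvdn_exp //; have := ali i; lia.
Qed.

Lemma params_lattice_inj : {in admissible &, injective params_lattice}.
Proof.
have p1 := prime_gt1 p_prime.
move=> [j [al a]] [j' [al' a']].
rewrite inE => /and3P[/= _ /finset.setDP[Aj Nj] /ffun_onP Ha].
rewrite inE => /and3P[/= _ /finset.setDP[Aj' Nj'] /ffun_onP Ha'] eqL.
have gt0 (c : {ffun 'I_m.+1 -> 'I_e.+1}) k : (0 < p ^ c k)%N.
  by rewrite expn_gt0 prime_gt0.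
have /(lattice_sub_dvd (gt0 al'))[dvd1 modb] : params_lattice (j, (al, a)) `<=`
  params_lattice (j', (al', a')) by rewrite eqL.
have /(lattice_sub_dvd (gt0 al))[dvd2 _] : params_lattice (j', (al', a')) `<=`
  params_lattice (j, (al, a)) by rewrite eqL.
have eqal : al = al'.
  apply/ffunP => k; apply/val_inj/eqP.
  by rewrite /= eqn_leq -!(dvdn_Pexp2l _ _ p1) dvd1 dvd2.
subst al'.
(* The level is determined by the exponents, being the largest one they allow. *)
have eqj : j = j'.
  apply: val_inj => /=; case: (ltngtP j j') => // lt_j.
    by rewrite (fintype.subsetP (exponentsS _ _ lt_j)) in Nj.
  by rewrite (fintype.subsetP (exponentsS _ _ lt_j)) in Nj'.
subst j'; congr (_, (_, _)); apply/ffunP => i; apply: val_inj.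
have al0 : (j < al ord0)%N.
  by move: Aj; rewrite inE => /andP[_ /forallP/(_ ord0)]; rewrite /min_exponent /=; lia.
(* Multipliers below [p ^ j] give values below [p ^ al ord0], so congruent values are equal. *)
have := modb (fun=> erefl) i; have := Ha i; have := Ha' i; rewrite !inE /= => ha' ha.
rewrite !modz_nat => -[]; rewrite !modn_small.
- by move/eqP; rewrite eqn_pmul2l ?expn_gt0 ?prime_gt0 // => /eqP.
- by rewrite -[in ltnRHS](subnK (ltnW al0)) expnD ltn_pmul2l ?expn_gt0 ?prime_gt0.
- by rewrite -[in ltnRHS](subnK (ltnW al0)) expnD ltn_pmul2l ?expn_gt0 ?prime_gt0.
Qed.

End Family.

Theorem theorem7p6 (p n e : nat) (p_prime : prime p)
    (n_ge2 : (2 <= n)%N) (e_ge1 : (1 <= e)%N) :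
  \sum_(1 <= j < (e %/ n).+1)
     p%:Z ^+ ((n - 2) * j)%N *
     (binz (e%:Z - 1 - n%:Z * j%:Z) (n - 2)%N
      - binz (e%:Z - 1 - n%:Z * (j%:Z + 1)) (n - 2)%N)
  <= (g n p e)%:Z.
Proof.
case: n n_ge2 => [|[|m]] // _; rewrite !subSS subn0.
have := leq_card_fset_set (@finite_irr_subrings m.+2 p e)
  (params_lattice_inj p_prime) (@params_lattice_irr p m e p_prime).
rewrite -/(g m.+2 p e) -lez_nat; apply: le_trans.
rewrite card_admissible //.
(* The family runs over all levels up to [e]; those beyond [e %/ m.+2] contribute a nonnegative
   amount and are dropped. *)
rewrite [X in _ <= Posz X](@big_cat_nat _ _ _ (e %/ m.+2).+1) //=; last first.
  by rewrite ltnS leq_div.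
rewrite PoszD ler_wpDr // -[leRHS]natz natr_sum; apply: ler_sum => j _.
rewrite natz PoszM mulrC -[p%:Z]natz -natrX natz ler_wpM2r //.
have -> : j%:Z + 1 = j.+1%:Z by lia.
rewrite -!card_exponents cardsD (finset.setIidPr (exponentsS _ _ (leqnSn j))).
by rewrite subzn // subset_leq_card // exponentsS.
Qed.
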